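(* For all integers $m,r\ge 0$, $$P_{m+r,m}(x)=\begin{cases}1 & \text{if } (m,r)=(0,0),\\[2pt] \sum_{k=1}^{m}\frac{1}{k}\binom{m-1}{k-1}\binom{m}{k-1}x^{k-1} & \text{if } r=0,\ m\ge 1,\\[2pt] x\sum_{i=0}^{m}\sum_{j=0}^{r-1}P_{m-i,m-i}(x)\,P_{r-j-1,r-j-1}(x)\,P_{j+i,i}(x) & \text{if } r\ge 1,\end{cases}$$ where $P_{n,m}(x)=\sum_{k=0}^{n}p_{n,m,k}x^k$.
   Context: A Dyck path of semilength $n\ge 0$ is a lattice path in $\mathbb{Z}\times\mathbb{Z}$ from $(0,0)$ to $(2n,0)$ using up steps $U=(1,1)$ and down steps $D=(1,-1)$; it is allowed to go below the $x$-axis. Write it as a word $P_1P_2\cdots P_{2n}$ over $\{U,D\}$. An up step is under the $x$-axis if it goes from height $-h$ to height $-h+1$ for some $h\ge 1$. A Dyck path is $(n,m)$-flawed if it has semilength $n$ and exactly $m$ up steps under the $x$-axis. A peak is a position $i$ with $P_iP_{i+1}=UD$. Let $p_{n,m,k}$ be the number of $(n,m)$-flawed paths with exactly $k$ peaks (the empty path has $0$ peaks). *)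

(* Defs.v *)
From HB Require Import structures.
From mathcomp Require Import all_boot all_order all_algebra.
Set Implicit Arguments.
Unset Strict Implicit.
Unset Printing Implicit Defensive.
Import Order.TTheory GRing.Theory Num.Theory.
Local Open Scope ring_scope.

(* A word over {U, D} is a sequence of booleans, U = true and D = false.
   Positions are numbered from 0: step i goes from abscissa i to i + 1. *)
Definition U : bool := true.
Definition D : bool := false.

Definition step_val (s : bool) : int := if s == U then 1 else -1.

Definition height (w : seq bool) (i : nat) : int :=
  \sum_(s <- take i w) step_val s.

(* No positivity condition: the path may go below the x-axis. *)
Definition dyck_path (n : nat) (w : (2 * n)%N.-tuple bool) : bool :=
  height w (2 * n)%N == 0.

(* The default value of nth is irrelevant, as i < size w. *)
Definition under_up (w : seq bool) (i : nat) : bool :=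
  [&& (i < size w)%N, nth D w i == U & height w i < 0].

Definition flaws (w : seq bool) : nat :=
  (\sum_(i < size w) under_up w i)%N.

Definition is_peak (w : seq bool) (i : nat) : bool :=
  [&& (i.+1 < size w)%N, nth D w i == U & nth D w i.+1 == D].

Definition peaks (w : seq bool) : nat :=
  (\sum_(i < size w) is_peak w i)%N.

Definition flawed_path (n m : nat) (w : (2 * n)%N.-tuple bool) : bool :=
  dyck_path w && (flaws w == m).

Definition num_flawed (n m k : nat) : nat :=
  #|[set w : (2 * n)%N.-tuple bool | flawed_path m w & peaks w == k]|.

(* Coefficients in rat because of the factors 1/k in the Narayana numbers. *)
Definition flawed_poly (n m : nat) : {poly rat} :=
  \sum_(k < n.+1) (num_flawed n m k)%:R *: 'X^k.

(* Main.v *)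
Require Import Defs.
From HB Require Import structures.
From mathcomp Require Import all_boot all_order all_algebra.
From mathcomp Require Import zify ring.
Set Implicit Arguments.
Unset Strict Implicit.
Unset Printing Implicit Defensive.
Import Order.TTheory GRing.Theory Num.Theory.
Local Open Scope ring_scope.

(* A path with an up step above the axis factors uniquely as [u U A D v], where
   [U A D] is its last excursion above the axis: [u] ends at height 0, [A] stays
   weakly above and [v] weakly below the height where it starts. No peak of the path
   straddles [u] and [U], or [D] and [v], and the peaks of [U A D] are one more than
   the valleys of [A], that is, the peaks of the mirror image of [A], which stays
   weakly below the axis. Weighting words by [y ^ flaws * x ^ peaks], this
   factorization becomes a Cauchy product, and the recurrence is its coefficient of
   [y ^ m]. For paths below the axis, the number of suffixes with given numbers of
   steps and peaks has a closed form, a difference of products of binomials that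
   obeys the same Pascal-like recurrences; at equal numbers of up and down steps it
   is a Narayana number. *)

(** * Statistics on words, recursive in the starting height *)

Fixpoint ends_at0 (h : int) (w : seq bool) : bool :=
  if w is s :: w' then ends_at0 (h + step_val s) w' else h == 0.

Fixpoint nonpos_path (h : int) (w : seq bool) : bool :=
  if w is s :: w' then (h <= 0) && nonpos_path (h + step_val s) w' else h == 0.

(** From [h > 0] the current excursion can be finished, but no new one can begin. *)
Fixpoint no_up_from0 (h : int) (w : seq bool) : bool :=
  if w is s :: w' then ~~ (s && (h == 0)) && no_up_from0 (h + step_val s) w'
  else h == 0.

Fixpoint flaws_from (h : int) (w : seq bool) : nat :=
  if w is s :: w' then ((s && (h < 0)%R) + flaws_from (h + step_val s)%R w')%N
  else 0%N.

(* [p] is the step that precedes [w]. *)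
Fixpoint peaks_after (p : bool) (w : seq bool) : nat :=
  if w is s :: w' then ((p && ~~ s) + peaks_after s w')%N else 0%N.

(* The sum of [f u * g v] over all factorizations [w = u ++ c :: v]. *)
Fixpoint conv_at (R : comNzRingType) (c : bool) (f g : seq bool -> R)
    (w : seq bool) : R :=
  if w is s :: w' then
    f [::] * ((s == c)%:R * g w') + conv_at c (fun u => f (s :: u)) g w'
  else 0.

Lemma nonpos_path_gt0 (h : int) (w : seq bool) :
  0 < h -> nonpos_path h w = false.
Proof. by case: w => [|s w] /= h_gt0; [lia | rewrite lt_geF]. Qed.

Lemma nonpos_path_short (w : seq bool) (h : int) :
  h + (size w)%:Z < 0 -> nonpos_path h w = false.
Proof.
elim: w h => [|s w IHw] h /= hlt; first lia.
by rewrite IHw ?andbF // /step_val; case: (s == U); lia.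
Qed.

Lemma no_up_from0_nonpos (w : seq bool) (h : int) :
  h <= 0 -> no_up_from0 h w = nonpos_path h w.
Proof.
elim: w h => [//|[] w IHw] h h_le0 /=; rewrite h_le0 /step_val /=.
  have [->|h_neq0] := eqVneq h 0; first by rewrite /= nonpos_path_gt0.
  by rewrite IHw //; lia.
by rewrite IHw //; lia.
Qed.

Lemma ends_at0E (w : seq bool) (h : int) :
  ends_at0 h w = (h + \sum_(s <- w) step_val s == 0).
Proof.
elim: w h => [|s w IHw] h /=; first by rewrite big_nil addr0.
by rewrite IHw big_cons addrA.
Qed.

Lemma ends_at0_count (w : seq bool) (h : int) :
  ends_at0 h w = (h + (2 * count id w)%:Z == (size w)%:Z).
Proof.
elim: w h => [|[] w IHw] h /=; first by rewrite addr0.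
  by rewrite IHw /step_val /=; lia.
by rewrite IHw /step_val /=; lia.
Qed.

Lemma flaws_from_le (w : seq bool) (h : int) :
  (flaws_from h w <= count id w)%N.
Proof.
elim: w h => [//|s w IHw] h /=; apply: leq_add (IHw _).
by case: s; case: (h < 0).
Qed.

Lemma peaks_after_le (w : seq bool) (p : bool) :
  (peaks_after p w <= p + count id w)%N.
Proof.
elim: w p => [//|s w IHw] p /=; have := IHw s.
by case: p; case: s => /=; lia.
Qed.

(** From [h <= 0], getting above the axis takes an up step leaving 0, which is not a flaw; so
    staying below means that every up step is a flaw. *)
Lemma nonpos_pathE (w : seq bool) (h : int) : h <= 0 ->
  nonpos_path h w = ends_at0 h w && (flaws_from h w == count id w).
Proof.
elim: w h => [|[] w IHw] h h_le0 /=; first by rewrite andbT.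
- rewrite h_le0 /step_val /=; have [->|h_neq0] := eqVneq h 0.
    rewrite nonpos_path_gt0 //= add0n add1n.
    by rewrite ltn_eqF ?andbF // ltnS flaws_from_le.
  by rewrite (_ : h < 0) ?IHw ?eqSS //; lia.
by rewrite h_le0 IHw // /step_val /=; lia.
Qed.

Lemma flawsE (w : seq bool) : flaws w = flaws_from 0 w.
Proof.
suff gen (h : int) : (\sum_(i < size w)
    [&& (i < size w)%N, nth D w i == U & (h + height w i < 0)%R])%N = flaws_from h w.
  by rewrite -gen /flaws /under_up; apply: eq_bigr => i _; rewrite add0r.
elim: w h => [|s w IHw] h /=; first by rewrite big_ord0.
rewrite big_ord_recl /= /height take0 big_nil addr0 eqb_id -IHw.
congr addn; apply: eq_bigr => i _.
by rewrite /bump /= big_cons addrA.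
Qed.

Lemma peaksE (w : seq bool) : peaks w = peaks_after false w.
Proof.
(* A letter in front makes the induction work; the letter D creates no peak there. *)
suff gen p : (\sum_(i < (size w).+1) is_peak (p :: w) i)%N = peaks_after p w.
  by rewrite -gen big_ord_recl /is_peak /= andbF; apply: eq_bigr.
elim: w p => [|s w IHw] p.
  by rewrite big_ord_recl big_ord0 /is_peak.
rewrite big_ord_recl /= -IHw; congr addn.
by rewrite /is_peak /=; case: p; case: s.
Qed.

(** * Sums over all words of a given length *)

Lemma sum_tupleS (R : nmodType) (n : nat) (f : seq bool -> R) :
  \sum_(w : n.+1.-tuple bool) f w =
  \sum_(w : n.-tuple bool) f (true :: w) + \sum_(w : n.-tuple bool) f (false :: w).
Proof.
rewrite (reindex (fun p : bool * n.-tuple bool => cons_tuple p.1 p.2)) /=; last first.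
  exists (fun w => (thead w, behead_tuple w)) => [[s w]|w] _ /=.
    by congr (_, _); apply: val_inj.
  by rewrite [RHS]tuple_eta; apply: val_inj.
rewrite -(pair_bigA _ (fun s (w : n.-tuple bool) => f (s :: w))) /=.
by rewrite big_bool.
Qed.

Lemma sum_tuple0 (R : nmodType) (f : seq bool -> R) :
  \sum_(w : 0.-tuple bool) f w = f [::].
Proof.
rewrite (eq_bigr (fun=> f [::])) => [|w _]; last by rewrite tuple0.
by rewrite sumr_const card_tuple expn0.
Qed.

Lemma sum_tuple_negb (R : nmodType) (n : nat) (f : seq bool -> R) :
  \sum_(w : n.-tuple bool) f (map negb w) = \sum_(w : n.-tuple bool) f w.
Proof.
elim: n f => [|n IHn] f.
  by rewrite (sum_tuple0 (fun w => f (map negb w))) (sum_tuple0 f).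
rewrite (sum_tupleS n (fun w => f (map negb w))) (sum_tupleS n f) /= addrC.
by rewrite (IHn (fun w => f (true :: w))) (IHn (fun w => f (false :: w))).
Qed.

Lemma conv_at_eql (R : comNzRingType) (c : bool) (f1 f2 g : seq bool -> R) w :
  f1 =1 f2 -> conv_at c f1 g w = conv_at c f2 g w.
Proof.
elim: w f1 f2 => [//|s w IHw] f1 f2 eqf /=.
by rewrite eqf; congr (_ + _); apply: IHw => u; apply: eqf.
Qed.

Lemma conv_atZl (R : comNzRingType) (c : bool) (a : R) (f g : seq bool -> R) w :
  conv_at c (fun u => a * f u) g w = a * conv_at c f g w.
Proof.
elim: w f => [|s w IHw] f /=; first by rewrite mulr0.
by rewrite (IHw (fun u => f (s :: u))) mulrDr !mulrA.
Qed.

(** Once the position [i] of the cut letter is fixed, [u] and [v] range freely over words of lengths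
    [i] and [n - i]. *)
Lemma sum_conv_at (R : comNzRingType) (c : bool) (n : nat) (f g : seq bool -> R) :
  \sum_(w : n.+1.-tuple bool) conv_at c f g w =
  \sum_(i < n.+1)
    (\sum_(u : i.-tuple bool) f u) * (\sum_(v : (n - i).-tuple bool) g v).
Proof.
have headE (a : R) (k : nat) :
    \sum_(w : k.-tuple bool) a * ((true == c)%:R * g w) +
    \sum_(w : k.-tuple bool) a * ((false == c)%:R * g w) =
    a * \sum_(w : k.-tuple bool) g w.
  rewrite -!mulr_sumr -mulrDr -mulrDl.
  by case: c; rewrite /= ?addr0 ?add0r mul1r.
elim: n f => [|n IHn] f; rewrite sum_tupleS /= !big_split /= addrACA headE.
  by rewrite big_ord1 (sum_tuple0 f) !(sum_tuple0 (conv_at _ _ _)) !addr0.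
rewrite [RHS]big_ord_recl (sum_tuple0 f); congr (_ + _).
rewrite !(IHn (fun u => f (_ :: u))) -big_split /=.
by apply: eq_bigr => i _; rewrite -mulrDl (sum_tupleS _ f).
Qed.

(** * Weights and the last excursion above the axis *)

Section Weights.

Variables (R : comNzRingType) (x y : R).

Definition nonpos_weight (h : int) (p : bool) (w : seq bool) : R :=
  (nonpos_path h w)%:R * x ^+ peaks_after p w.

Definition flawed_weight (h : int) (p : bool) (w : seq bool) : R :=
  (ends_at0 h w)%:R * (y ^+ flaws_from h w * x ^+ peaks_after p w).

Definition flawed_nonpos_weight (w : seq bool) : R :=
  y ^+ flaws_from 0 w * nonpos_weight 0 false w.

(** Here [w] starts inside the last excursion, at height [h + 1], and the cut is at the D that
    returns to 0. Before it the word stays at height 1 or more, so its mirror image, lifted by 1,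
    runs weakly below the axis from [- h] to 0. After a step [p], a word closed by D has [p] more
    peaks than valleys, hence the factor [x ^+ p]. *)
Lemma conv_at_nonneg (w : seq bool) (h : nat) (p : bool) :
  x ^+ p * conv_at false (fun u => nonpos_weight (- h%:Z) (~~ p) (map negb u))
             flawed_nonpos_weight w =
  (no_up_from0 h.+1%:Z w)%:R * (y ^+ flaws_from h.+1%:Z w * x ^+ peaks_after p w).
Proof.
elim: w h p => [|[] w IHw] h p /=.
- by rewrite mulr0 mul0r.
- rewrite /step_val /= mul0r mulr0 add0r andbF add0n.
  have -> : h.+1%:Z + 1 = h.+2%:Z by lia.
  rewrite -(IHw h.+1 true) /=.
  rewrite (@conv_at_eql _ _ _ (fun u => x ^+ (~~ p) *
     nonpos_weight (- h.+1%:Z) (~~ true) (map negb u))); last first.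
    move=> u; rewrite /nonpos_weight /= /step_val /= andbT exprD.
    have -> : - h%:Z <= 0 by lia.
    have -> : - h%:Z + -1 = - h.+1%:Z by lia.
    by rewrite /=; ring.
  rewrite conv_atZl mulrA -exprD; congr (x ^+ _ * _); by case: p.
rewrite /step_val /= mul1r andbT.
case: h => [|h].
  (* This D ends the excursion: a longer [u] would go below height 1, so it has weight 0. *)
  rewrite (@conv_at_eql _ _ _ (fun u => 0 * 0)); last first.
    by move=> u; rewrite /nonpos_weight /= /step_val /= nonpos_path_gt0 // mul0r mulr0.
  rewrite conv_atZl mul0r addr0 no_up_from0_nonpos // subrr.
  by rewrite /flawed_nonpos_weight /nonpos_weight /= !exprD; ring.
have -> : h.+2%:Z + -1 = h.+1%:Z by lia.
rewrite !exprD.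
transitivity (x ^+ p * ((no_up_from0 h.+1%:Z w)%:R *
    (y ^+ flaws_from h.+1%:Z w * x ^+ peaks_after false w))); last by ring.
rewrite -(IHw h false) mul1r; congr (_ * _).
rewrite {1}/nonpos_weight /= !mul0r add0r.
apply: conv_at_eql => u; rewrite /nonpos_weight /= /step_val /=.
have -> : - h.+1%:Z + 1 = - h%:Z by lia.
by rewrite andbF.
Qed.

(* The first term is the weight of the words without excursion above the axis; in
   the second one, the [U] and the [D] delimit the last such excursion. *)
Lemma flawed_weight_decomp (w : seq bool) (h : int) (p : bool) :
  flawed_weight h p w =
  (no_up_from0 h w)%:R * (y ^+ flaws_from h w * x ^+ peaks_after p w) +
  x * conv_at true (flawed_weight h p)
        (conv_at false (fun u => nonpos_weight 0 false (map negb u))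
          flawed_nonpos_weight) w.
Proof.
rewrite /flawed_weight.
elim: w h p => [|s w IHw] h p /=; first by rewrite mulr0 addr0.
set G := conv_at false _ _ in IHw *.
rewrite (@conv_at_eql _ _ _ (fun u =>
  (y ^+ (s && (h < 0)) * x ^+ (p && ~~ s)) *
   flawed_weight (h + step_val s) s u)); last first.
  by move=> u; rewrite /flawed_weight !exprD; ring.
rewrite conv_atZl !exprD.
have -> : (ends_at0 (h + step_val s) w)%:R *
  (y ^+ (s && (h < 0)) * y ^+ flaws_from (h + step_val s) w *
    (x ^+ (p && ~~ s) * x ^+ peaks_after s w)) =
  (y ^+ (s && (h < 0)) * x ^+ (p && ~~ s)) * ((ends_at0 (h + step_val s) w)%:R *
    (y ^+ flaws_from (h + step_val s) w * x ^+ peaks_after s w)) :> R by ring.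
rewrite IHw mulrDr !expr0 !mulr1.
case: s => /=; last by rewrite mul0r mulr0; ring.
have [->|h_neq0] := eqVneq h 0; last by rewrite /= !mul0r; ring.
(* This U may open the last excursion: the words without a later one give the head term of the
   convolution, with empty [u]. *)
have := conv_at_nonneg w 0 true; rewrite expr1 oppr0 -/G => eqG.
rewrite andbF -[0 + step_val true]/(1%:Z) -eqG /=; ring.
Qed.

Lemma sum_flawed_odd (p : bool) (n : nat) : odd n ->
  \sum_(w : n.-tuple bool) flawed_weight 0 p w = 0.
Proof.
move=> n_odd; apply: big1 => w _; rewrite /flawed_weight ends_at0_count size_tuple.
by rewrite (_ : _ == _ = false) ?mul0r //; lia.
Qed.

Lemma sum_nonpos_odd (p : bool) (n : nat) : odd n ->
  \sum_(w : n.-tuple bool) nonpos_weight 0 p w = 0.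
Proof.
move=> n_odd; apply: big1 => w _.
rewrite /nonpos_weight nonpos_pathE // ends_at0_count size_tuple.
by rewrite (_ : _ == _ = false) ?mul0r //; lia.
Qed.

Lemma sum_flawed_nonpos (n : nat) :
  \sum_(w : (2 * n).-tuple bool) flawed_nonpos_weight w =
  y ^+ n * \sum_(w : (2 * n).-tuple bool) nonpos_weight 0 false w.
Proof.
rewrite mulr_sumr; apply: eq_bigr => w _.
rewrite /flawed_nonpos_weight /nonpos_weight nonpos_pathE // ends_at0_count.
rewrite size_tuple; case: andP => [[bal_w /eqP ->]|_]; last by rewrite !mul0r !mulr0.
by congr (y ^+ _ * _); lia.
Qed.

Lemma sum_ord_even (f : nat -> R) (n : nat) :
  (forall i, odd i -> f i = 0) -> \sum_(i < 2 * n) f i = \sum_(i < n) f (2 * i)%N.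
Proof.
move=> f_odd; elim: n => [|n IHn]; first by rewrite !big_ord0.
rewrite mulnS !big_ord_recr /= IHn (f_odd (2 * n).+1) ?addr0 //.
by rewrite /= mul2n odd_double.
Qed.

(** [a], [b] and [n - a - b] are the semilengths of the parts before, inside and after the last
    excursion; in the last part every up step is a flaw. *)
Lemma sum_flawed_rec (n : nat) :
  \sum_(w : (2 * n.+1).-tuple bool) flawed_weight 0 false w =
  y ^+ n.+1 * \sum_(w : (2 * n.+1).-tuple bool) nonpos_weight 0 false w +
  x * \sum_(a < n.+1) (\sum_(w : (2 * a).-tuple bool) flawed_weight 0 false w) *
    \sum_(b < (n - a).+1) (\sum_(w : (2 * b).-tuple bool) nonpos_weight 0 false w) *
      (y ^+ (n - a - b) *
        \sum_(w : (2 * (n - a - b)).-tuple bool) nonpos_weight 0 false w).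
Proof.
have convE (k : nat) :
  \sum_(w : (2 * k).+1.-tuple bool)
    conv_at false (fun u => nonpos_weight 0 false (map negb u))
          flawed_nonpos_weight w =
  \sum_(b < k.+1) (\sum_(w : (2 * b).-tuple bool) nonpos_weight 0 false w) *
    (y ^+ (k - b) *
       \sum_(w : (2 * (k - b)).-tuple bool) nonpos_weight 0 false w).
  rewrite sum_conv_at.
  pose f i := (\sum_(w : i.-tuple bool) nonpos_weight 0 false w) *
    \sum_(w : (2 * k - i).-tuple bool) flawed_nonpos_weight w.
  have f_odd i : odd i -> f i = 0 by move=> ?; rewrite /f sum_nonpos_odd ?mul0r.
  transitivity (\sum_(i < 2 * k.+1) f i).
    (* The added index [2 * k + 1] is odd, so its term is 0. *)
    rewrite (_ : (2 * k.+1 = (2 * k).+2)%N) ?mulnS //.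
    rewrite [RHS]big_ord_recr f_odd /= ?mul2n ?odd_double // addr0.
    by apply: eq_bigr => i _; rewrite (sum_tuple_negb _ (nonpos_weight _ _)) /f mul2n.
  rewrite sum_ord_even //; apply: eq_bigr => b _.
  by rewrite /f -mulnBr sum_flawed_nonpos.
under eq_bigr => w _ do rewrite flawed_weight_decomp no_up_from0_nonpos //.
rewrite big_split /= -sum_flawed_nonpos; congr (_ + _).
  apply: eq_bigr => w _.
  by rewrite /flawed_nonpos_weight /nonpos_weight mulrCA.
rewrite -mulr_sumr; congr (x * _).
rewrite (_ : (2 * n.+1 = (2 * n).+2)%N); last by rewrite mulnS.
rewrite sum_conv_at.
pose f i := (\sum_(w : i.-tuple bool) flawed_weight 0 false w) *
  \sum_(w : ((2 * n).+1 - i).-tuple bool)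
    conv_at false (fun u => nonpos_weight 0 false (map negb u))
          flawed_nonpos_weight w.
have f_odd i : odd i -> f i = 0 by move=> ?; rewrite /f sum_flawed_odd ?mul0r.
transitivity (\sum_(i < 2 * n.+1) f i); first by rewrite (_ : (2 * n.+1 = (2 * n).+2)%N) ?mulnS.
rewrite sum_ord_even //; apply: eq_bigr => a _.
by rewrite /f -convE mulnBr -subSn // leq_mul2l -ltnS ltn_ord.
Qed.

End Weights.

(** * From weights to the polynomials of flawed paths *)

Lemma flawed_polyE (n m : nat) :
  flawed_poly n m = \sum_(w : (2 * n).-tuple bool)
    (ends_at0 0 w && (flaws_from 0 w == m))%:R * 'X^(peaks_after false w).
Proof.
transitivity (\sum_(k < n.+1) \sum_(w : (2 * n).-tuple bool)
    (ends_at0 0 w && (flaws_from 0 w == m))%:R *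
    ((peaks_after false w == k)%:R * 'X^k) : {poly rat}).
  apply: eq_bigr => k _; rewrite /num_flawed cardE -sum1_size big_enum_cond /=.
  rewrite natr_sum scaler_suml [LHS]big_mkcond /=; apply: eq_bigr => w _.
  rewrite inE /flawed_path /dyck_path /height take_oversize ?size_tuple //.
  rewrite ends_at0E add0r flawsE peaksE.
  case: (_ == _); case: (_ == _); case: (_ == _);
    by rewrite /= ?mul0r ?mul1r ?mulr0 ?scale1r.
rewrite exchange_big /=; apply: eq_bigr => w _; rewrite -mulr_sumr.
have [/andP[bal_w _]|_] := boolP (_ && _); last by rewrite !mul0r.
(* Truncating at degree [n] loses nothing: each peak uses one of the [n] up steps. *)
have peaks_lt : (peaks_after false w < n.+1)%N.
  move: bal_w (peaks_after_le w false); rewrite ends_at0_count size_tuple; lia.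
rewrite (bigD1 (Ordinal peaks_lt)) //= eqxx mul1r big1 ?addr0 // => k.
by rewrite eq_sym -val_eqE /= => /negbTE ->; rewrite mul0r.
Qed.

Lemma flawed_poly_small (n m : nat) : (n < m)%N -> flawed_poly n m = 0.
Proof.
move=> lt_nm; rewrite flawed_polyE big1 // => w _.
rewrite (_ : _ && _ = false) ?mul0r //; apply/negbTE/andP => -[].
rewrite ends_at0_count size_tuple => /eqP bal_w /eqP fl_w.
by have := flaws_from_le w 0; rewrite fl_w /=; lia.
Qed.

Lemma sum_nonposE (n : nat) :
  \sum_(w : (2 * n).-tuple bool) nonpos_weight 'X 0 false w = flawed_poly n n.
Proof.
rewrite flawed_polyE; apply: eq_bigr => w _; rewrite /nonpos_weight.
rewrite nonpos_pathE // ends_at0_count size_tuple.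
by congr ((nat_of_bool _)%:R * _); lia.
Qed.

Lemma sum_nonpos_polyC (n : nat) :
  \sum_(w : (2 * n).-tuple bool) nonpos_weight 'X%:P 0 false w =
  (flawed_poly n n)%:P.
Proof.
rewrite -sum_nonposE rmorph_sum; apply: eq_bigr => w _.
by rewrite rmorphM rmorphXn rmorph_nat.
Qed.

(** In polynomials over polynomials, the outer variable marks flaws and the inner one peaks. *)
Lemma coef_sum_flawed (n m : nat) :
  (\sum_(w : (2 * n).-tuple bool) flawed_weight 'X%:P 'X 0 false w)`_m =
  flawed_poly n m.
Proof.
rewrite coef_sum flawed_polyE; apply: eq_bigr => w _.
rewrite /flawed_weight mulr_natl coefMn -rmorphXn coefMC coefXn eq_sym.
by case: (ends_at0 _ _); rewrite /= ?mulr1n // mulr0n mul0r.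
Qed.

Lemma flawed_poly_rec (n m : nat) : (m <= n)%N ->
  flawed_poly n.+1 m = 'X * \sum_(a < n.+1) \sum_(b < (n - a).+1)
    flawed_poly b b * flawed_poly (n - a - b) (n - a - b) *
    (if (m < n - a - b)%N then 0 else flawed_poly a (m - (n - a - b))).
Proof.
move=> le_mn; rewrite -coef_sum_flawed sum_flawed_rec coefD sum_nonpos_polyC.
rewrite coefMC coefXn ltn_eqF // mul0r add0r coefCM coef_sum; congr (_ * _).
apply: eq_bigr => a _; rewrite mulr_sumr coef_sum; apply: eq_bigr => b _.
rewrite !sum_nonpos_polyC.
rewrite (_ : _ * _ = (flawed_poly b b * flawed_poly (n - a - b) (n - a - b))%:P *
  ((\sum_(w : (2 * a).-tuple bool) flawed_weight 'X%:P 'X 0 false w) *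
   'X^(n - a - b))); last by rewrite rmorphM /=; ring.
by rewrite coefCM coefMXn coef_sum_flawed.
Qed.

(** Puts the semilength [c] of the last part outermost, as it fixes how many flaws are left for the
    first part. *)
Lemma triangular_sumC (V : nmodType) (n : nat) (F : nat -> nat -> nat -> V) :
  \sum_(a < n.+1) \sum_(b < (n - a).+1) F a b (n - a - b)%N =
  \sum_(c < n.+1) \sum_(a < (n - c).+1) F a (n - c - a)%N c.
Proof.
have widenE (a : 'I_n.+1) (G : nat -> V) :
    \sum_(c < (n - a).+1) G c = \sum_(c < n.+1 | (c + a <= n)%N) G c.
  rewrite (big_ord_widen n.+1 G) ?ltnS ?leq_subr //.
  by apply: eq_bigl => c; have := ltn_ord a; lia.
transitivity (\sum_(a < n.+1) \sum_(c < n.+1 | (c + a <= n)%N) F a (n - a - c)%N c).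
  apply: eq_bigr => a _; rewrite -(widenE a (fun c => F a (n - a - c)%N c)).
  rewrite (reindex_inj rev_ord_inj) /=; apply: eq_bigr => c _.
  by have := ltn_ord c; rewrite ltnS subSS => le_c; rewrite subKn.
rewrite (exchange_big_dep xpredT) //=; apply: eq_bigr => c _.
rewrite (widenE c (fun a => F a (n - c - a)%N c)) /=.
by apply: eq_big => a; [rewrite addnC | rewrite subnAC].
Qed.

Lemma flawed_poly_addSn (m r : nat) :
  flawed_poly (m + r).+1 m = 'X * \sum_(i < m.+1) \sum_(j < r.+1)
    flawed_poly (m - i) (m - i) * flawed_poly (r - j) (r - j) *
    flawed_poly (j + i) i.
Proof.
rewrite flawed_poly_rec ?leq_addr //; congr (_ * _).
rewrite (triangular_sumC _ (fun a b c => flawed_poly b b * flawed_poly c c *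
  (if (m < c)%N then 0 else flawed_poly a (m - c)))).
(* A last part with [c > m] has too many flaws; otherwise [c = m - i], where [i] flaws are left for
   the first part. *)
rewrite -addSn big_split_ord /= [X in _ + X]big1 ?addr0; last first.
  by move=> c _; apply: big1 => a _; rewrite leq_addr mulr0.
rewrite (reindex_inj rev_ord_inj) /=; apply: eq_bigr => i _.
have le_im : (i <= m)%N by rewrite -ltnS ltn_ord.
rewrite subSS ltnNge leq_subr /= subKn //.
rewrite (_ : (m + r - (m - i)).+1 = i + r.+1)%N; last by lia.
(* A first part of semilength [a < i] cannot have [i] flaws, so [a = i + j]. *)
rewrite big_split_ord /= big1 ?add0r => [|a _]; last first.
  by rewrite (@flawed_poly_small a) ?mulr0.
apply: eq_bigr => j _; rewrite [(j + i)%N]addnC; congr (_ * _).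
by rewrite mulrC; congr (_ * flawed_poly _ _); lia.
Qed.

(** * Closed form for paths below the axis *)

(** The value 0 at [k = 0], where truncated subtraction would give 1, keeps Pascal's rule valid for
    all [k]. *)
Definition bin_pred (n k : nat) : nat := if k is k'.+1 then 'C(n, k') else 0.

(* [after_up] and [after_down] count the words with [u] up and [d] down steps that
   stay weakly below the axis and end on it, with [k] peaks, when the preceding
   step is U or D. Each is a difference of two products, as in the reflection
   principle: [after_up] vanishes on the forbidden line [d = u + 1]. *)
Definition after_up (u d k : nat) : rat :=
  if d is d'.+1 then
    'C(u, k)%:R * (bin_pred d' k)%:R - (bin_pred u k)%:R * 'C(d', k)%:R
  else (k == 0%N)%:R.

Definition after_down (u d k : nat) : rat :=
  if u is u'.+1 then
    'C(u', k)%:R * 'C(d, k)%:R - (bin_pred u' k)%:R * 'C(d, k.+1)%:R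
  else (k == 0%N)%:R.

Lemma binS_pred (n k : nat) : 'C(n.+1, k) = ('C(n, k) + bin_pred n k)%N.
Proof. by case: k => [|k]; rewrite ?bin0 // binS. Qed.

(** The two terms match a first step U or D; the D completes a peak. *)
Lemma after_upS (u d k : nat) :
  after_up u.+1 d.+1 k =
  after_up u d.+1 k + (if k is k'.+1 then after_down u.+1 d k' else 0).
Proof.
case: k => [|k]; rewrite /after_up /after_down /= ?mulr0 ?mul0r ?subr0 ?addr0 //.
by rewrite binS (binS_pred u k) !natrD; ring.
Qed.

Lemma after_downS (u d k : nat) :
  after_down u.+1 d.+1 k = after_up u d.+1 k + after_down u.+1 d k.
Proof.
by rewrite /after_up /after_down binS (binS_pred d k) !natrD; ring.
Qed.

Lemma sum_nonpos_weightS (p : bool) (l : nat) (h : int) : h <= 0 ->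
  \sum_(w : l.+1.-tuple bool) nonpos_weight 'X h p w =
  \sum_(w : l.-tuple bool) nonpos_weight 'X (h + 1) true w +
  'X^p * \sum_(w : l.-tuple bool) nonpos_weight 'X (h - 1) false w :> {poly rat}.
Proof.
move=> h_le0; rewrite sum_tupleS mulr_sumr; congr (_ + _); apply: eq_bigr => w _.
  by rewrite /nonpos_weight /= h_le0 andbF.
by rewrite /nonpos_weight /= h_le0 /= andbT exprD mulrCA.
Qed.

(** The two claims feed each other in the induction on length. The first one includes [d = u + 1], a
    start at height 1, because an up step from 0 leads there. *)
Lemma coef_sum_nonpos (l u d k : nat) : (u + d = l)%N ->
  ((d <= u.+1)%N ->
   (\sum_(w : l.-tuple bool) nonpos_weight 'X (d%:Z - u%:Z) true w)`_k =
   after_up u d k) /\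
  ((d <= u)%N ->
   (\sum_(w : l.-tuple bool) nonpos_weight 'X (d%:Z - u%:Z) false w)`_k =
   after_down u d k).
Proof.
elim: l u d k => [|l IHl] u d k eq_l.
  have [-> ->] : u = 0%N /\ d = 0%N by lia.
  split=> _; rewrite (sum_tuple0 (nonpos_weight _ _ _)) /nonpos_weight /=;
    by rewrite mul1r coef1.
have step p : (d <= u)%N ->
    (\sum_(w : l.+1.-tuple bool) nonpos_weight 'X (d%:Z - u%:Z) p w)`_k =
    after_up u.-1 d k + (if d is d'.+1 then
      if p then (if k is k'.+1 then after_down u d' k' else 0)
      else after_down u d' k else 0).
  move=> le_du; rewrite sum_nonpos_weightS; last by lia.
  rewrite coefD (_ : d%:Z - u%:Z + 1 = d%:Z - u.-1%:Z); last by lia.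
  rewrite (IHl _ _ _ _).1; [|lia|lia]; congr (_ + _).
  case: d eq_l le_du => [|d] eq_l le_du.
    (* Going down here leaves too few steps to climb back to 0. *)
    rewrite big1 ?mulr0 ?coef0 // => w _.
    by rewrite /nonpos_weight nonpos_path_short ?mul0r // size_tuple; lia.
  rewrite (_ : d.+1%:Z - u%:Z - 1 = d%:Z - u%:Z); last by lia.
  case: p; last by rewrite mul1r (IHl _ _ _ _).2 //; lia.
  by rewrite coefXM; case: (k) => [//|k'] /=; rewrite (IHl _ _ _ _).2 //; lia.
split=> [|le_du].
  rewrite leq_eqVlt => /orP[/eqP d_eq|].
    rewrite big1 ?coef0 => [|w _]; last first.
      by rewrite /nonpos_weight nonpos_path_gt0 ?mul0r //; lia.
    by rewrite d_eq /after_up mulrC subrr.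
  rewrite ltnS => le_du; rewrite step //; clear step.
  by case: u d eq_l le_du => [|u] [|d] // _ _; rewrite ?addr0 // after_upS.
rewrite step //; clear step; case: u d eq_l le_du => [|u] [|d] // _ _; last by rewrite after_downS.
rewrite addr0 /after_up /after_down bin0n.
by case: k => [|k] /=; rewrite ?bin0 ?mulr1 ?mulr0 ?mul0r ?subr0.
Qed.

(** This is the Narayana number with indices [n + 1] and [k + 1]: a nonempty path below the axis has
    one more valley than peaks. *)
Lemma after_down_narayana (n k : nat) :
  after_down n.+1 n.+1 k = k.+1%:R^-1 * 'C(n, k)%:R * 'C(n.+1, k)%:R.
Proof.
rewrite /after_down; apply: (mulfI (_ : k.+1%:R != 0)); first by rewrite pnatr_eq0.
rewrite -!mulrA mulVKf ?pnatr_eq0 //.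
case: k => [|k]; first by rewrite !bin0 /=; ring.
have := mul_bin_left n k; have := mul_bin_left n.+1 k.+1; rewrite subSS /=.
move=> /(congr1 (fun i => i%:R : rat)) eq1 /(congr1 (fun i => i%:R : rat)) eq2.
move: eq1 eq2; rewrite !natrM => eq1 eq2.
(* Both absorption identities give the factor [n - k], so [k + 2] times the subtracted product is
   [k + 1] times the other one. *)
rewrite mulrBr [_ * ('C(n, k)%:R * _)]mulrCA eq1.
rewrite ['C(n, k)%:R * _]mulrCA [X in _ - X]mulrA -eq2.
by rewrite -[k.+2]addn1 natrD; ring.
Qed.

Lemma flawed_poly_narayana (n : nat) :
  flawed_poly n.+1 n.+1 =
  \sum_(k < n.+1) (k.+1%:R^-1 * 'C(n, k)%:R * 'C(n.+1, k)%:R) *: 'X^k.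
Proof.
apply/polyP => k; rewrite -sum_nonposE.
rewrite -(poly_def _ (fun k => k.+1%:R^-1 * 'C(n, k)%:R * 'C(n.+1, k)%:R)) coef_poly.
have := @coef_sum_nonpos (2 * n.+1) n.+1 n.+1 k _; rewrite subrr.
case=> [|_ ->] //; first by rewrite mul2n addnn.
rewrite after_down_narayana; case: ltnP => // lt_nk.
by rewrite bin_small // mulr0 mul0r.
Qed.

Theorem theorem3p6 (m r : nat) :
  flawed_poly (m + r) m =
    if (m == 0%N) && (r == 0%N) then 1
    else if r == 0%N then
      \sum_(1 <= k < m.+1)
        (k%:R^-1 * 'C(m - 1, k - 1)%:R * 'C(m, k - 1)%:R) *: 'X^(k - 1)
    else
      'X * \sum_(0 <= i < m.+1) \sum_(0 <= j < r)
        flawed_poly (m - i) (m - i) *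
        flawed_poly (r - j - 1) (r - j - 1) *
        flawed_poly (j + i) i.
Proof.
case: r => [|r] /=.
  rewrite addn0 andbT; case: m => [|m].
    by rewrite -sum_nonposE (sum_tuple0 (nonpos_weight _ _ _)) /nonpos_weight /= mul1r.
  rewrite flawed_poly_narayana big_add1 big_mkord /=.
  by apply: eq_bigr => k _; rewrite !subn1.
rewrite andbF addnS flawed_poly_addSn big_mkord; congr (_ * _).
apply: eq_bigr => i _; rewrite big_mkord; apply: eq_bigr => j _.
by rewrite subnAC subn1.
Qed.
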